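(* Let $G$ be a finitely generated group. Suppose that $G$ is relatively finitely presented with respect to a collection $H_{\Lambda} = \{H_{\lambda} \mid \lambda \in \Lambda\}$ of its subgroups, let $X$ be the finite symmetric relative generating set of a finite relative presentation of $G$ with respect to $H_\Lambda$, and suppose that the relative Dehn function $\delta_{G,H_{\Lambda}}^{rel}$ is well-defined. Then every subgroup $K \leq G$ satisfies exactly one of the following conditions: 1) $K$ is finite. 2) $K$ is infinite and conjugate (in $G$) to a subgroup of some $H_{\lambda}$, $\lambda \in \Lambda$. 3) $K$ is unbounded in the relative Cayley graph $\Gamma(G, X \cup \mathcal{H})$.
   Context: Relative presentations. Let $G$ be a group and $H_\Lambda=\{H_\lambda \mid \lambda\in\Lambda\}$ a collection of subgroups of $G$ (peripheral subgroups). A relative generating set of $G$ with respect to $H_\Lambda$ is a symmetric subset $X \subseteq G$ such that $G$ is generated by $X\cup\bigcup_{\lambda \in \Lambda} H_\lambda$. Let $\widetilde H_\lambda$ be pairwise disjoint isomorphic copies of the groups $H_\lambda$, also disjoint from $X$, and put $\mathcal H=\bigcup_{\lambda\in\Lambda}(\widetilde H_\lambda\setminus\{1\})$. Let $F=(\ast_{\lambda\in\Lambda}\widetilde H_\lambda)\ast F(X)$, where $F(X)$ is the free group over $X$, let $\varepsilon\colon F\to G$ be the canonical epimorphism, and let $\mathcal R\subseteq F$ be a subset whose normal closure in $F$ is $\ker \varepsilon$. With $\mathcal S_\lambda$ the set of all words over $\widetilde H_\lambda \setminus\{1\}$ representing the identity, the presentation $\langle X,\mathcal H \mid S=1,\ S\in\bigcup_\lambda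 \mathcal S_\lambda,\ R=1,\ R\in\mathcal R\rangle$ is called a relative presentation of $G$ with respect to $H_\Lambda$. It is finite if $X$ and $\mathcal R$ are finite; if a finite one exists, $G$ is relatively finitely presented with respect to $H_\Lambda$. Relative Dehn function. Fix a finite relative presentation. For a word $w$ over $X\cup\mathcal H$ representing the identity in $G$, let $\mathrm{vol}(w)$ be the minimal $k$ such that $w=_F\prod_{i=1}^k f_i^{-1}R_i^{\pm1}f_i$ in $F$ with $f_i\in F$, $R_i\in\mathcal R$. The relative Dehn function is $\delta^{rel}_{G,H_\Lambda}(\ell)=\sup\{\mathrm{vol}(w)\}\in\mathbb N\cup\{\infty\}$, the supremum taken over all words $w$ of length at most $\ell$ over $X\cup\mathcal H$ representing the identity in $G$. It is well-defined if $\delta^{rel}_{G,H_\Lambda}(\ell)<\infty$ for all $\ell\in\mathbb N$; this property does not depend on the chosen finite relative presentation. Relative Cayley graph. $\Gamma(G,X\cup\mathcal H)$ is the Cayley graph of $G$ with respect to the generating set $X\cup\mathcal H$ (letters of $\mathcal H$ act via their images in $G$), with its path metric $d_{X \cup \mathcal H}$. A subgroup $K\le G$ is unbounded in it if it has infinite diameter with respect to $d_{X\cup\mathcal H}$. *)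

(* Defs.v *)
From HB Require Import structures.
From mathcomp Require Import all_boot.
From mathcomp Require Import boolp classical_sets cardinality.

Set Implicit Arguments.
Unset Strict Implicit.
Unset Printing Implicit Defensive.

Local Open Scope quotient_scope.
Local Open Scope classical_set_scope.
Local Open Scope group_scope.

Record subgroup (G : groupType) := Subgroup {
  subgroup_set :> set G;
  subgroup_closed : group_closed [in subgroup_set] }.

(* A wrapper around [set_type H], so that it can carry the group structure. *)
Definition subgroup_type (G : groupType) (H : subgroup G) : Type := set_type H.

Section SubgroupType.
Variables (G : groupType) (H : subgroup G).
HB.instance Definition _ := SubChoice.copy (subgroup_type H) (set_type H).
HB.instance Definition _ :=
  SubChoice_isSubGroup.Build G [in subgroup_set H] (subgroup_type H)
    (subgroup_closed H).
End SubgroupType.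

Definition generated (G : groupType) (S : set G) : set G :=
  smallest (fun M : set G => group_closed [in M]) S.

Definition finitely_generated (G : groupType) : Prop :=
  exists2 S : set G, finite_set S & generated S = [set: G].

Definition normal_subgroup (G : groupType) (N : set G) : Prop :=
  group_closed [in N] /\ (forall f g, N f -> N (f ^ g)).

Definition normal_closure (G : groupType) (S : set G) : set G :=
  smallest (@normal_subgroup G) S.

(* The free product of a family of groups [A] with the free group on [X]: words
   in the elements of the [A i] and the formal letters [x^{+1}] ([Fgen x true])
   and [x^{-1}] ([Fgen x false]), modulo free cancellation and the
   multiplication tables of the [A i].  Its universal property is given by
   [lift_morphism], [lift_gen], [lift_factor] and [lift_unique] below. *)

Section FreeProduct.
Variables (X I : Type) (A : I -> groupType).

Inductive fsymbol :=
  | Fgen of X & bool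
  | Ffactor (i : I) of A i.

Inductive fcong : seq fsymbol -> seq fsymbol -> Prop :=
  | fcong_refl u : fcong u u
  | fcong_sym u v : fcong u v -> fcong v u
  | fcong_trans u v w : fcong u v -> fcong v w -> fcong u w
  | fcong_cat u u' v v' : fcong u u' -> fcong v v' -> fcong (u ++ v) (u' ++ v')
  | fcong_gen x b : fcong [:: Fgen x b; Fgen x (~~ b)] [::]
  | fcong_one i : fcong [:: Ffactor (1 : A i)] [::]
  | fcong_mul i (a b : A i) :
      fcong [:: Ffactor a; Ffactor b] [:: Ffactor (a * b)].

Definition fword := {classic seq fsymbol}.
Definition fcongb (u v : fword) : bool := `[< fcong u v >].

Lemma fcongb_equiv : equiv_class_of fcongb.
Proof.
split=> [u|u v|v u w].
- exact/asboolP/fcong_refl.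
- by apply/asboolP/asboolP; apply: fcong_sym.
- move=> /asboolP uv /asboolP vw; apply/asboolP; exact: fcong_trans uv vw.
Qed.

Canonical fcong_equiv := EquivRelPack fcongb_equiv.

Definition free_product : Type := {eq_quot fcong_equiv}.
HB.instance Definition _ := Choice.copy free_product {eq_quot fcong_equiv}.
HB.instance Definition _ := Quotient.copy free_product {eq_quot fcong_equiv}.

Definition fclass (u : seq fsymbol) : free_product := \pi_free_product (u : fword).

Lemma fclassP u v : fclass u = fclass v <-> fcong u v.
Proof.
split=> [/eqP|uv]; last by apply/eqP; rewrite eqmodE; apply/asboolP.
by rewrite eqmodE => /asboolP.
Qed.

Lemma fclass_repr (f : free_product) : fclass (repr f) = f.
Proof. exact: reprK. Qed.

Lemma repr_fclass u : fcong (repr (fclass u)) u.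
Proof. by apply/fclassP; rewrite fclass_repr. Qed.

Definition fsymbol_inv (a : fsymbol) : fsymbol :=
  match a with
  | Fgen x b => Fgen x (~~ b)
  | Ffactor i a => Ffactor a^-1
  end.

Definition fword_inv (u : seq fsymbol) := rev (map fsymbol_inv u).

Definition fone : free_product := fclass [::].
Definition fmul (f g : free_product) : free_product :=
  fclass (repr f ++ repr g).
Definition finv (f : free_product) : free_product := fclass (fword_inv (repr f)).

Lemma fmul_class u v : fmul (fclass u) (fclass v) = fclass (u ++ v).
Proof. by apply/fclassP/fcong_cat; apply: repr_fclass. Qed.

Lemma fsymbol_invK : involutive fsymbol_inv.
Proof. by case=> [x b|i a] /=; rewrite ?negbK ?invgK. Qed.

Lemma fword_invK : involutive fword_inv.
Proof.
move=> u; rewrite /fword_inv map_rev revK -map_comp -[RHS]map_id.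
by apply: eq_map => a /=; rewrite fsymbol_invK.
Qed.

Lemma fword_invl u : fcong (fword_inv u ++ u) [::].
Proof.
elim: u => [|a u IHu]; first exact: fcong_refl.
rewrite /fword_inv map_cons rev_cons cat_rcons.
suff aV : fcong [:: fsymbol_inv a; a] [::].
  apply: fcong_trans IHu.
  apply: fcong_cat; first exact: fcong_refl.
  by apply: (@fcong_cat [:: _; _] [::] u u aV); apply: fcong_refl.
case: a => [x b|i a] /=.
  by rewrite -{2}[b]negbK; apply: fcong_gen.
apply: fcong_trans (fcong_mul _ _) _; rewrite mulVg; exact: fcong_one.
Qed.

Lemma fmulA : associative fmul.
Proof.
move=> f g h; rewrite -[f]fclass_repr -[g]fclass_repr -[h]fclass_repr.
by rewrite !fmul_class catA.
Qed.

Lemma fmul1 : left_id fone fmul.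
Proof. by move=> f; rewrite -[f]fclass_repr fmul_class. Qed.

Lemma fmulf1 : right_id fone fmul.
Proof. by move=> f; rewrite -[f]fclass_repr fmul_class cats0. Qed.

Lemma fmulV : left_inverse fone finv fmul.
Proof.
move=> f; rewrite -{2}[f]fclass_repr fmul_class; apply/fclassP/fword_invl.
Qed.

Lemma fmulfV : right_inverse fone finv fmul.
Proof.
move=> f; rewrite -{1}[f]fclass_repr fmul_class; apply/fclassP.
by rewrite -{1}[repr f]fword_invK; apply: fword_invl.
Qed.

HB.instance Definition _ :=
  isGroup.Build free_product fmulA fmul1 fmulf1 fmulV fmulfV.

Definition fgen (x : X) : free_product := fclass [:: Fgen x true].
Definition ffactor (i : I) (a : A i) : free_product := fclass [:: Ffactor a].

Lemma fclass_cat u v : fclass (u ++ v) = fclass u * fclass v.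
Proof. by rewrite -fmul_class. Qed.

Lemma fclass_nil : fclass [::] = 1.
Proof. by []. Qed.

Lemma ffactor_morphism i : monoid_morphism (@ffactor i).
Proof.
split=> [|a b]; first exact/fclassP/fcong_one.
rewrite /ffactor -fclass_cat; apply/fclassP/fcong_sym/fcong_mul.
Qed.

Section Lift.
Variables (T : groupType) (g : X -> T) (h : forall i, A i -> T).

Definition lift_symbol (a : fsymbol) : T :=
  match a with
  | Fgen x b => if b then g x else (g x)^-1
  | Ffactor i a => h a
  end.

Definition lift_word (u : seq fsymbol) : T := \prod_(a <- u) lift_symbol a.

Definition lift (f : free_product) : T := lift_word (repr f).

Hypothesis h_morphism : forall i, monoid_morphism (@h i).

Lemma lift_wordP u v : fcong u v -> lift_word u = lift_word v.
Proof.
rewrite /lift_word; elim=> {u v} //.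
- by move=> u v w _ -> _ ->.
- by move=> u u' v v' _ uu' _ vv'; rewrite !big_cat /= uu' vv'.
- move=> x [] /=; rewrite !big_cons !big_nil /= mulg1 ?mulgV ?mulVg //.
- by move=> i; rewrite big_cons !big_nil /= (h_morphism i).1 mulg1.
- by move=> i a b; rewrite !big_cons !big_nil /= (h_morphism i).2 !mulg1.
Qed.

Lemma lift_class u : lift (fclass u) = lift_word u.
Proof. exact/lift_wordP/repr_fclass. Qed.

Lemma lift_morphism : monoid_morphism lift.
Proof.
split=> [|f f']; first by rewrite -fclass_nil lift_class /lift_word big_nil.
rewrite -[f]fclass_repr -[f']fclass_repr -fclass_cat !lift_class.
exact: big_cat.
Qed.

Lemma lift_gen x : lift (fgen x) = g x.
Proof. by rewrite lift_class /lift_word big_seq1. Qed.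

Lemma lift_factor i (a : A i) : lift (ffactor a) = h a.
Proof. by rewrite lift_class /lift_word big_seq1. Qed.

Lemma lift_unique (k : free_product -> T) : monoid_morphism k ->
  (forall x, k (fgen x) = g x) -> (forall i a, k (@ffactor i a) = h a) ->
  k =1 lift.
Proof.
move=> [k1 kM] kg kh f; rewrite -[f]fclass_repr lift_class.
elim: (repr f : seq fsymbol) => [|a u IHu].
  by rewrite fclass_nil k1 /lift_word big_nil.
rewrite -cat1s fclass_cat kM IHu /lift_word big_cons; congr (_ * _).
case: a => [x []|i a] /=; [exact: kg| |exact: kh].
apply/(mulIg (g x)); rewrite mulVg -kg -kM /fgen -fclass_cat /=.
by rewrite -[RHS]k1; congr k; apply/fclassP/(fcong_gen x false).
Qed.

End Lift.
End FreeProduct.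

(* The set [nat] extended with infinity, [None] standing for infinity. *)

Definition enat := option nat.

Definition enat_le (x : enat) (n : nat) : bool :=
  if x is Some m then (m <= n)%N else false.

Definition enat_inf (S : set nat) : enat :=
  if pselect (exists n, `[< S n >]) is left e then Some (ex_minn e) else None.

Definition enat_sup (S : set enat) : enat :=
  enat_inf [set N | forall x, S x -> enat_le x N].

Lemma enat_inf_le (S : set nat) n :
  enat_le (enat_inf S) n <-> exists2 m, S m & (m <= n)%N.
Proof.
rewrite /enat_inf; case: pselect => [e|ne] /=.
  case: ex_minnP => m /asboolP Sm min_m; split=> [le_mn|[p Sp le_pn]].
    by exists m.
  by apply: leq_trans le_pn; apply/min_m/asboolP.
by split=> // -[m Sm _]; case: ne; exists m; apply/asboolP.
Qed.

Lemma enat_sup_le (S : set enat) n :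
  enat_le (enat_sup S) n <-> forall x, S x -> enat_le x n.
Proof.
rewrite enat_inf_le; split=> [[m /= Sm le_mn] x /Sm|Sn]; last by exists n.
by case: x => //= p le_pm; apply: leq_trans le_mn.
Qed.

Section RelativePresentations.
Variables (G : groupType) (L : Type) (H : L -> subgroup G) (X : set G).

(* [x] and [x^-1] in [X] give two distinct basis elements of the free factor
   F(X), as they do two distinct letters of the alphabet. *)
Definition relF : groupType :=
  free_product X (fun l : L => subgroup_type (H l)).

Definition epsilon : relF -> G :=
  lift (fun x : X => val x) (fun (l : L) (h : subgroup_type (H l)) => val h).

Lemma epsilon_morphism : monoid_morphism epsilon.
Proof. by apply: lift_morphism => l; split=> // h h'; apply: valM. Qed.

Definition relative_generating_set : Prop :=
  invg_closed [in X] /\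
  generated (X `|` \bigcup_l (H l : set G)) = [set: G].

Definition relative_presentation (R : set relF) : Prop :=
  relative_generating_set /\
  normal_closure R = [set f | epsilon f = 1].

Definition finite_relative_presentation (R : set relF) : Prop :=
  [/\ relative_presentation R, finite_set X & finite_set R].

(* The alphabet: the disjoint union of [X] and of the nontrivial elements of
   disjoint copies of the [H l]. *)
Definition letter : Type :=
  (X + {l : L & {h : subgroup_type (H l) | h != 1}})%type.

Definition letter_relF (a : letter) : relF :=
  match a with
  | inl x => fgen (fun l => subgroup_type (H l)) x
  | inr (existT l h) => @ffactor X L (fun l => subgroup_type (H l)) l (val h)
  end.

Lemma epsilon_letter (a : letter) : epsilon (letter_relF a) =
  match a with inl x => val x | inr (existT l h) => val (val h) end.
Proof.
have val_morphism l : monoid_morphism (fun h : subgroup_type (H l) => val h).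
  by split=> // h h'; apply: valM.
by case: a => [x|[l h]]; [apply: lift_gen | apply: lift_factor].
Qed.

Definition word_relF (w : seq letter) : relF := \prod_(a <- w) letter_relF a.

Definition conjugates_product (R : set relF) (k : nat) (f : relF) : Prop :=
  exists (c r : 'I_k -> relF) (s : 'I_k -> bool),
    (forall i, R (r i)) /\
    f = \prod_(i < k) ((c i)^-1 * (if s i then r i else (r i)^-1) * c i).

Definition vol (R : set relF) (w : seq letter) : enat :=
  enat_inf [set k | conjugates_product R k (word_relF w)].

Definition relative_Dehn (R : set relF) (n : nat) : enat :=
  enat_sup [set vol R w | w in
    [set w | (size w <= n)%N /\ epsilon (word_relF w) = 1]].

Definition relative_Dehn_well_defined (R : set relF) : Prop :=
  forall n, relative_Dehn R n <> None.

Definition cayley_adj (g h : G) : bool :=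
  `[< exists a : letter,
        h = g * epsilon (letter_relF a) \/ g = h * epsilon (letter_relF a) >].

Definition cayley_dist (g h : G) : enat :=
  enat_inf [set n | exists p, [/\ path cayley_adj g p, last g p = h
                                & size p = n]].

Definition cayley_diam (K : set G) : enat :=
  enat_sup [set d | exists g h, [/\ K g, K h & d = cayley_dist g h]].

Definition unbounded_in_cayley (K : set G) : Prop := cayley_diam K = None.

End RelativePresentations.

Definition conjugate_into (G : groupType) (K H : subgroup G) : Prop :=
  exists (g : G) (M : subgroup G),
    M `<=` H /\ (K : set G) = [set m ^ g | m in (M : set G)].

Definition exactly_one (P Q S : Prop) : Prop :=
  [\/ [/\ P, ~ Q & ~ S], [/\ ~ P, Q & ~ S] | [/\ ~ P, ~ Q & S]].

(* Main.v *)
(* Let the coned-off Cayley graph have as vertices the elements of [G] and the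
   cosets [g H_l], with [g] joined to the [g x], [x] in [X], and to the [g H_l].

   Fineness.  A function [phi l] on [G] for each [l] gives a cocycle on [F]: sum
   [phi l (g h) - phi l g] over the letters [h] of [H_l] in a word, [g] being
   the value of the prefix before [h].  On a product of [k] conjugates of
   relators it is at most [k] times its maximum on the translates of relators.
   Take for [phi l] the truncated word length in [H_l] with respect to the
   finitely many elements of [H_l] that occur in relators.  If a relation of
   length [n] starts with [h] in [H_l] and does not use the coset [H_l] again,
   its cocycle is the length of [h], which the relative Dehn function thus
   bounds.  Hence, for distinct vertices [u] and [v], only finitely many edges
   at [v] start a path of length at most [n] to [u] that does not return to
   [v].

   Fixed point.  Let the orbit of a vertex [x] under [K] be infinite of diameter
   [D], and take [n] minimal such that infinitely many points of the orbit are
   within distance [n] of some vertex [v].  By fineness most of these points are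
   joined to any other vertex by short paths only through [v], so for [g] in [K]
   with [g v <> v] a geodesic between suitable points of the orbit runs through
   both [v] and [g v], whence [d(v, g v) < D].  By induction on [D] some vertex
   [y] has a finite orbit.  If [K] is infinite it fixes [y], again by fineness
   because [G] acts freely on its own elements; so [y] is a coset [g H_l] and
   [K] lies in [g H_l g^-1]. *)

Require Import Defs.
From mathcomp Require Import all_boot all_order all_algebra zify.
From mathcomp Require Import boolp classical_sets cardinality.

Set Implicit Arguments.
Unset Strict Implicit.
Unset Printing Implicit Defensive.

Local Open Scope classical_set_scope.
Local Open Scope group_scope.

(** * Preliminaries on finite sets and subgroups *)

Lemma finite_List_In T (s : seq T) : finite_set [set x | List.In x s].
Proof.
elim: s => [|y s IHs]; first by apply: (@sub_finite_set _ _ set0).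
apply: (@sub_finite_set _ _ ([set y] `|` [set x | List.In x s])).
  by move=> x [<-|xs]; [left|right].
by rewrite finite_setU; split=> //; apply: finite_set1.
Qed.

Section Subgroup.
Variables (G : groupType) (K : subgroup G).

Lemma subgroup1 : (K : set G) 1.
Proof. exact: set_mem (subgroup_closed K).1. Qed.

Lemma subgroupM g h : (K : set G) g -> (K : set G) h -> (K : set G) (g * h).
Proof.
move=> /mem_set Kg /mem_set Kh; apply: set_mem.
exact: (group_closedM (subgroup_closed K)).
Qed.

Lemma subgroupV g : (K : set G) g -> (K : set G) g^-1.
Proof.
move=> /mem_set Kg; apply: set_mem.
exact: (group_closedV (subgroup_closed K)).
Qed.

Lemma subgroup_elt g : (K : set G) g -> exists a : subgroup_type K, val a = g.
Proof. by move=> Kg; exists (exist _ g (mem_set Kg)). Qed.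

End Subgroup.

Lemma conjugate_intoP (G : groupType) (K H : subgroup G) (g : G) :
  (forall k, (K : set G) k -> (H : set G) (g^-1 * k * g)) -> conjugate_into K H.
Proof.
move=> KH; pose M : set G := [set m | (K : set G) (m ^ g^-1)].
have MC : group_closed [in M].
  split=> [|x y /set_mem Mx /set_mem My]; apply: mem_set; rewrite /M /=.
    by rewrite conj1g; apply: set_mem (subgroup_closed K).1.
  rewrite conjMg conjVg; apply: set_mem.
  by apply: (subgroup_closed K).2; apply: mem_set.
exists g^-1, (Subgroup MC); split=> [m|] /=.
  by move=> /KH; rewrite conjgE invgK !mulgA mulVg mul1g mulgVK.
apply/seteqP; split=> [k Kk|_ [m Mm <-] //].
by exists (k ^ g); rewrite /M /= -conjgM ?mulgV ?conjg1.
Qed.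

(** * Paths of bounded length in a graph *)

Section Reach.
Variables (V : Type) (adj : V -> V -> Prop).

(* A path of length at most (not exactly) [n], all of whose vertices, endpoints
   included, satisfy [P]. *)
Inductive reach (P : set V) : nat -> V -> V -> Prop :=
  | reach_nil n v : P v -> reach P n v v
  | reach_cons n u w v :
      P u -> adj u w -> reach P n w v -> reach P n.+1 u v.

Lemma reach_le P m n u v : (m <= n)%N -> reach P m u v -> reach P n u v.
Proof.
move=> mn r; elim: r n mn => [k x Px n _|k x w y Px xw _ IH [//|n] kn].
  exact: reach_nil.
exact: reach_cons xw (IH _ kn).
Qed.

Lemma reach_sub P Q n u v : P `<=` Q -> reach P n u v -> reach Q n u v.
Proof.
move=> PQ; elim=> {n u v} [n v /PQ|n u w v /PQ Qu uw _]; first exact: reach_nil.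
exact: reach_cons.
Qed.

Lemma reach_start P n u v : reach P n u v -> P u.
Proof. by case. Qed.

Lemma reach0 P u v : reach P 0 u v -> u = v.
Proof. by move=> r; inversion r. Qed.

Lemma reach_end P n u v : reach P n u v -> P v.
Proof. by elim. Qed.

Lemma reach_trans P m n u v w :
  reach P m u v -> reach P n v w -> reach P (m + n) u w.
Proof.
move=> uv vw; elim: uv vw => [k x _|k x y z Px xy _ IH] vw.
  by apply: reach_le vw; rewrite leq_addl.
by rewrite addSn; apply: reach_cons xy (IH vw).
Qed.

Lemma reach_sym P n u v : (forall x y, adj x y -> adj y x) ->
  reach P n u v -> reach P n v u.
Proof.
move=> adjC; elim=> {n u v} [n v Pv|n u w v Pu /adjC wu _ IH].
  exact: reach_nil.
rewrite -addn1; apply: reach_trans (IH) _.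
apply: reach_cons (reach_end IH) wu _; exact: reach_nil.
Qed.

Lemma reach_split P n u v x : reach P n u v ->
  reach (P `\ x) n u v \/
  exists a b, [/\ (a + b <= n)%N, reach P a u x & reach P b x v].
Proof.
elim=> {n u v} [n v Pv|n u w v Pu uw wv IH].
- have [<-|vx] := pselect (v = x); last by left; apply: reach_nil.
  by right; exists 0%N, 0%N; split=> //; apply: reach_nil.
- have [<-|ux] := pselect (u = x).
  right; exists 0%N, n.+1; split=> //; first exact: reach_nil.
  exact: reach_cons uw wv.
case: IH => [IH|[a [b [ab wx xv]]]]; first by left; apply: reach_cons uw IH.
by right; exists a.+1, b; split=> //; apply: reach_cons uw wx.
Qed.

(** Cut the path at its last visit to [x]: the tail avoids [x], and the edge from [x] to [e]
    accounts for [n.-1]. *)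
Lemma reach_last P n u v x : reach P n u v ->
  [\/ reach (P `\ x) n u v, x = v |
      exists2 e, adj x e & reach (P `\ x) n.-1 e v].
Proof.
elim=> {n u v} [n v Pv|n u w v Pu uw wv IH].
  have [->|vx] := pselect (v = x); first by constructor 2.
  by constructor 1; apply: reach_nil.
case: IH => [{}wv|->|[e xe ev]]; last 2 first.
- by constructor 2.
- by apply: Or33; exists e => //; exact: reach_le (leq_pred n) ev.
have [ux|ux] := pselect (u = x).
  by apply: Or33; exists w; rewrite -?ux in uw wv *.
by constructor 1; apply: reach_cons uw wv.
Qed.

End Reach.

Lemma reach_map (V : Type) (adj : V -> V -> Prop) (f : V -> V)
    (P Q : set V) n u v :
  (forall x y, adj x y -> adj (f x) (f y)) -> (forall x, P x -> Q (f x)) ->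
  reach adj P n u v -> reach adj Q n (f u) (f v).
Proof.
move=> fadj PQ; elim=> {n u v} [n v /PQ|n u w v /PQ Qu /fadj uw _].
  exact: reach_nil.
exact: reach_cons.
Qed.

(** * Bounded orbits on a fine graph *)

Section BoundedOrbits.
Variables (G : groupType) (V : Type) (adj : V -> V -> Prop) (act : G -> V -> V).
Hypothesis adjC : forall u v, adj u v -> adj v u.
Hypothesis act1 : forall v, act 1 v = v.
Hypothesis actM : forall g h v, act (g * h) v = act g (act h v).
Hypothesis act_adj : forall g u v, adj u v -> adj (act g u) (act g v).
Hypothesis fine : forall n u v, u <> v ->
  finite_set [set e | adj v e /\ reach adj [set~ v] n e u].
Variable K : set G.
Hypothesis KM : forall k k', K k -> K k' -> K (k * k').
Hypothesis KV : forall k, K k -> K k^-1.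

Let orbit x := [set act k x | k in K].

Lemma actK g : cancel (act g) (act g^-1).
Proof. by move=> v; rewrite -actM mulVg act1. Qed.

Lemma actVK g : cancel (act g^-1) (act g).
Proof. by move=> v; rewrite -actM mulgV act1. Qed.

Lemma reach_act n u v g :
  reach adj setT n u v -> reach adj setT n (act g u) (act g v).
Proof. by apply: reach_map => // x y; apply: act_adj. Qed.

Lemma reach_act_avoid n u v w g :
  reach adj [set~ w] n u v -> reach adj [set~ act g w] n (act g u) (act g v).
Proof.
apply: reach_map => [x y|x /= xw]; first exact: act_adj.
by move=> /(can_inj (actK g)).
Qed.

Lemma orbit_act k x y : K k -> orbit x (act k y) <-> orbit x y.
Proof.
move=> Kk; split=> -[k' Kk' e].
  by exists (k^-1 * k'); [exact/KM/Kk'/KV|rewrite actM e actK].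
by exists (k * k'); [exact: KM|rewrite actM e].
Qed.

(** A path from [v] to [y] leaves [v] for the last time towards some neighbour [e], from which [u]
    is reached through [y] avoiding [v]. Fineness allows finitely many [e], each with finitely many
    orbit points within distance [n]. *)
Lemma avoiding_finite x n m u v : u <> v ->
  (forall w, finite_set (orbit x `&` reach adj setT n w)) ->
  finite_set [set y | [/\ orbit x y, reach adj setT n.+1 v y &
                          reach adj [set~ v] m y u]].
Proof.
move=> uv nfin.
pose E := [set e | adj v e /\ reach adj [set~ v] (n + m) e u].
apply: (@sub_finite_set _ _
  ([set v] `|` \bigcup_(e in E) (orbit x `&` reach adj setT n e))).
  move=> y [/= xy vy yu].
  have := reach_last v vy; rewrite setTD => -[r|<-|].
  - by case: (reach_start r).
  - by left.
  move=> [e ve ey].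
  right; exists e; first by split=> //; apply: reach_trans ey yu.
  by split=> //; apply: reach_sub ey.
rewrite finite_setU; split; first exact: finite_set1.
exact: bigcup_finite (fine _ uv) _.
Qed.

Lemma finite_orbit D x : (forall k, K k -> reach adj setT D x (act k x)) ->
  exists D' y, [/\ finite_set (orbit y), exists m, reach adj setT m x y &
                   forall k, K k -> reach adj setT D' y (act k y)].
Proof.
elim: D x => [|D IH] x xD.
  exists 0%N, x; split=> //; last by exists 0%N; apply: reach_nil.
  apply: (@sub_finite_set _ _ [set x]); last exact: finite_set1.
  by move=> _ [k /xD r <-]; rewrite -(reach0 r).
have [fin|infin] := pselect (finite_set (orbit x)).
  by exists D.+1, x; split=> //; exists 0%N; apply: reach_nil.
have exn : exists n,
    `[< exists v, infinite_set (orbit x `&` reach adj setT n v) >].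
  exists D.+1; apply/asboolP; exists x; apply: contra_not infin.
  by apply: sub_finite_set => _ [k /[dup] Kk /xD ? <-]; split=> //; exists k.
case: (ex_minnP exn) => -[|n] /asboolP[v vinf] minn.
  case: vinf; apply: (@sub_finite_set _ _ [set v]); last exact: finite_set1.
  by move=> y [_ r]; rewrite -(reach0 r).
have nfin w : finite_set (orbit x `&` reach adj setT n w).
  apply: contrapT => winf; have: (n < n)%N by apply/minn/asboolP; exists w.
  by rewrite ltnn.
have [y0 [[k0 Kk0 y0E] vy0]] := infinite_setN0 vinf.
suff /IH[D' [y [fy [m vy] yD]]] g : K g -> reach adj setT D v (act g v).
  exists D', y; split=> //; exists (D.+1 + n.+1 + m)%N.
  apply: reach_trans vy; apply: reach_trans (xD _ Kk0) _.
  by rewrite y0E; apply: reach_sym.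
(* It remains to show d(v, g v) <= D: pick [y] and [y'] in the orbit that are
   cut off from [g v] by [v], respectively from [v] by [g v]. *)
move=> Kg; set u := act g v.
have [->|uv] := pselect (u = v); first exact: reach_nil.
have vu : v <> u by move=> /esym.
(* The point [v] is discarded as well, so that a path from [y] to [v] has an edge. *)
have [y [[xy vy] /not_orP[ny yv]]] :
    (orbit x `&` reach adj setT n.+1 v) `\`
    ([set y | [/\ orbit x y, reach adj setT n.+1 v y &
                  reach adj [set~ v] (D.+1 + n.+1) y u]] `|` [set v]) !=set0.
  apply: infinite_setN0; apply: infinite_setD => //; rewrite finite_setU; split.
    exact: avoiding_finite.
  exact: finite_set1.
(* Translated by [g], the conditions say that [y'] has no short path to [v] avoiding [u] and is
   farther than [n] from [v]. *)
have [y1 [[xy1 vy1] /not_orP[ny1 ny1']]] :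
    (orbit x `&` reach adj setT n.+1 v) `\`
    ([set y | [/\ orbit x y, reach adj setT n.+1 v y &
                  reach adj [set~ v] D.+1 y (act g^-1 v)]] `|`
    [set y | orbit x y /\ reach adj setT n (act g^-1 v) y]) !=set0.
  apply: infinite_setN0; apply: infinite_setD => //; rewrite finite_setU; split.
    apply: avoiding_finite => // e; apply: vu.
    by rewrite /u -[X in act _ X]e actVK.
  exact: nfin.
set y' := act g y1.
have uy' : reach adj setT n.+1 u y' by apply: reach_act.
have xy' : orbit x y' by apply/orbit_act.
have ny' : ~ reach adj [set~ u] D.+1 y' v.
  move=> /(@reach_act_avoid _ _ _ _ g^-1); rewrite /y' /u !actK => r.
  by apply: ny1; split.
have ny'' : ~ reach adj setT n v y'.
  move=> /(@reach_act _ _ _ g^-1); rewrite /y' actK => r.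
  by apply: ny1'; split.
have yy' : reach adj setT D.+1 y y'.
  case: xy xy' => k Kk <- [k' Kk' <-].
  rewrite -[k'](mulVKg k) actM; apply: reach_act; apply: xD.
  exact/KM/Kk'/KV.
(* The path from [y] to [y'] meets [v]. Otherwise continue from [y'] to [u]: this continuation
   either avoids [v], against [ny], or meets it before [u], which puts [y'] within [n] of [v]. *)
have [|[a [b [abD yv' vy']]]] := reach_split v yy'.
  rewrite setTD => r.
  have [|[a [b [abn y'v vu']]]] := reach_split v (reach_sym adjC uy').
    rewrite setTD => r'; case: ny; split=> //; exact: reach_trans r r'.
  case: ny''; case: b abn vu' => [|b] abn r0.
    by case: vu; exact: reach0 r0.
  apply: reach_sym => //; apply: reach_le y'v.
  by move: abn; rewrite addnS ltnS; apply: leq_trans; rewrite leq_addr.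
(* The segment from [y] to [v] uses at least one edge, which leaves at most [D] for the segment from
   [v] to [y']; the latter must meet [u] by [ny']. *)
case: a abD yv' => [|a] abD; first by move=> r; case: yv; exact: reach0 r.
move=> _; rewrite addSn ltnS in abD.
have bD : (b <= D)%N by apply: leq_trans abD; rewrite leq_addl.
have [|[a' [b' [abn vu' _]]]] := reach_split u vy'.
  rewrite setTD => /(reach_sym adjC) r; case: ny'; apply: reach_le r.
  exact: leqW.
apply: reach_le vu'; apply: leq_trans bD; apply: leq_trans abn.
exact: leq_addr.
Qed.

(** Take for [e] the vertex after the last visit to [y] on a path to [act k0 y]. Every translate of
    [e] starts a path between two distinct points of the finite orbit of [y] that avoids the first
    one, so fineness applies to each pair. *)
Lemma moved_neighbor_orbit D y k0 : finite_set (orbit y) ->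
  (forall k, K k -> reach adj setT D y (act k y)) -> K k0 -> act k0 y <> y ->
  exists2 e, adj y e & finite_set (orbit e).
Proof.
move=> fy yD Kk0 k0y; have := reach_last y (yD _ Kk0); rewrite setTD.
case=> [r|/esym//|[e ye er]]; first by case: (reach_start r).
exists e => //; pose E a b := [set e | adj a e /\ reach adj [set~ a] D.-1 e b].
apply: (@sub_finite_set _ _
  (\bigcup_(a in orbit y) \bigcup_(b in orbit y `\ a) E a b)).
  move=> _ [k Kk <-]; exists (act k y); first by exists k.
  exists (act k (act k0 y)).
    split; first by exists (k * k0); [exact: KM|rewrite actM].
    by move=> /(can_inj (actK k)).
  by split; [exact: act_adj|exact: reach_act_avoid].
apply: bigcup_finite => // a _; apply: bigcup_finite => [|b [_ ba]].
  exact: finite_setD.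
exact: fine.
Qed.

End BoundedOrbits.

(** * Cocycles on the free product *)

Section Cocycle.
Variables (G : groupType) (L : Type) (H : L -> subgroup G) (X : set G).
Variable phi : L -> G -> int.

Local Notation symbol := (fsymbol X (fun l : L => subgroup_type (H l))).
Local Notation eval :=
  (lift_word (fun x : X => val x)
     (fun (l : L) (h : subgroup_type (H l)) => val h)).

(* [g] is the value in [G] of the prefix read so far. *)
Definition cocycle_symbol (g : G) (a : symbol) : int :=
  match a with
  | Fgen _ _ => 0%R
  | @Ffactor _ _ _ l h => (phi l (g * val h) - phi l g)%R
  end.

Fixpoint cocycle_word (g : G) (u : seq symbol) : int :=
  if u is a :: u' then
    (cocycle_symbol g a + cocycle_word (g * eval [:: a]) u')%R
  else 0%R.

Definition cocycle (g : G) (f : relF H X) : int := cocycle_word g (repr f).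

Lemma eval_cat u v : eval (u ++ v) = eval u * eval v.
Proof. exact: big_cat. Qed.

Lemma eval_fcong u v : fcong u v -> eval u = eval v.
Proof. by apply: lift_wordP => l; split=> // h h'; apply: valM. Qed.

Lemma cocycle_word_cat g u v :
  cocycle_word g (u ++ v) = (cocycle_word g u + cocycle_word (g * eval u) v)%R.
Proof.
elim: u g => [|a u IHu] g /=.
  by rewrite /lift_word big_nil mulg1 GRing.add0r.
by rewrite IHu -GRing.addrA -mulgA -eval_cat.
Qed.

(** Free letters contribute nothing, and the differences of [phi] telescope along the multiplication
    tables. *)
Lemma cocycle_word_fcong g u v :
  fcong u v -> cocycle_word g u = cocycle_word g v.
Proof.
move=> uv; elim: uv g => {u v} //=.
- by move=> u v w _ IHuv _ IHvw g; rewrite IHuv IHvw.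
- move=> u u' v v' uu' IHu _ IHv g.
  by rewrite !cocycle_word_cat IHu IHv (eval_fcong uu').
- by move=> l g; rewrite mulg1 GRing.subrr.
- move=> l a b g; rewrite /lift_word big_seq1 /= mulgA.
  by rewrite !GRing.addr0 GRing.addrC GRing.subrKA.
Qed.

Lemma cocycle_class g u : cocycle g (fclass u) = cocycle_word g u.
Proof. exact/cocycle_word_fcong/repr_fclass. Qed.

Lemma cocycle1 g : cocycle g 1 = 0%R.
Proof. by rewrite -[1]/(fclass [::]) cocycle_class. Qed.

Lemma cocycleM g f f' :
  cocycle g (f * f') = (cocycle g f + cocycle (g * epsilon f) f')%R.
Proof. by rewrite [f * f']/(fclass _) cocycle_class cocycle_word_cat. Qed.

Lemma epsilon1 : epsilon (1 : relF H X) = 1.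
Proof. exact: (epsilon_morphism H X).1. Qed.

Lemma epsilonM (f f' : relF H X) : epsilon (f * f') = epsilon f * epsilon f'.
Proof. exact: (epsilon_morphism H X).2. Qed.

Lemma epsilonV (f : relF H X) : epsilon f^-1 = (epsilon f)^-1.
Proof.
by apply: (mulIg (epsilon f)); rewrite -epsilonM !mulVg epsilon1.
Qed.

Lemma cocycleV g f : cocycle g f^-1 = (- cocycle (g * (epsilon f)^-1) f)%R.
Proof.
by apply/eqP; rewrite -GRing.addr_eq0 -epsilonV -cocycleM mulVg cocycle1.
Qed.

(** As [r] evaluates to [1], [c^-1] and [c] are read along the same path in opposite directions and
    cancel. *)
Lemma cocycle_conj g c r : epsilon r = 1 ->
  cocycle g (r ^ c) = cocycle (g * (epsilon c)^-1) r.
Proof.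
move=> r1; rewrite conjgE !cocycleM cocycleV epsilonV r1 mulg1; lia.
Qed.

Lemma cocycle_conjugates_product (M : nat) (R : set (relF H X)) k g f :
  (forall r, R r -> epsilon r = 1) ->
  (forall r g, R r -> `|cocycle g r|%R <= Posz M)%R ->
  conjugates_product R k f -> (`|cocycle g f| <= Posz (k * M))%R.
Proof.
move=> R1 RM [c [r [s [Rr ->]]]].
elim: k => [|k IHk] in g c r s Rr *.
  by rewrite big_ord0 cocycle1.
rewrite big_ord_recl cocycleM.
set r0 := if _ then _ else _.
have r01 : epsilon r0 = 1.
  by rewrite /r0; case: ifP; rewrite ?epsilonV R1 ?invg1.
have r0M g' : (`|cocycle g' r0| <= Posz M)%R.
  by rewrite /r0; case: ifP; rewrite ?cocycleV ?Num.Theory.normrN RM.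
rewrite -mulgA -conjgE cocycle_conj // mulSn PoszD.
apply: Order.POrderTheory.le_trans (Num.Theory.ler_normD _ _) _.
apply: Num.Theory.lerD => //.
exact: (IHk _ (c \o fintype.lift ord0) (r \o fintype.lift ord0)
  (s \o fintype.lift ord0) (fun i => Rr _)).
Qed.

Lemma cocycle_letter g (a : letter H X) : cocycle g (letter_relF a) =
  match a with
  | inl _ => 0%R
  | inr (existT l h) => (phi l (g * val (val h)) - phi l g)%R
  end.
Proof.
by case: a => [x|[l h]]; rewrite cocycle_class /= ?GRing.addr0.
Qed.

End Cocycle.

(** * Isolated peripheral letters and the relative Dehn function *)

Section Isolated.
Variables (G : groupType) (L : Type) (H : L -> subgroup G) (X : set G).
Variable R : set (relF H X).

Local Notation symbol := (fsymbol X (fun l : L => subgroup_type (H l))).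
Local Notation factor a :=
  (@Ffactor X L (fun l : L => subgroup_type (H l)) _ a).

Definition relator_symbols : set symbol :=
  [set a | exists2 r, R r & List.In a (repr r : seq symbol)].

Definition relator_parts (l : L) : set G :=
  [set val a | a in [set a : subgroup_type (H l) | relator_symbols (factor a)]].

(* The ball of radius [n] in the subgroup of [H l] generated by the relator
   parts; it is reduced to [1] for all but finitely many [l]. *)
Fixpoint ball (l : L) (n : nat) : set G :=
  if n is m.+1 then
    [set g | ball l m g \/
      exists2 w, relator_parts l w & ball l m (g * w) \/ ball l m (g * w^-1)]
  else [set 1].

Lemma ball_subgroup l n : ball l n `<=` H l.
Proof.
elim: n => [_ ->|n IHn g /=]; first exact: subgroup1.
case=> [/IHn//|[_ [a _ <-] [/IHn|/IHn] Hg]].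
  rewrite -(mulgK (val a) g); apply: subgroupM => //; apply: subgroupV.
  exact: set_mem (valP a).
rewrite -(mulgVK (val a) g); apply: subgroupM => //.
exact: set_mem (valP a).
Qed.

Lemma ball_le l m n : (m <= n)%N -> ball l m `<=` ball l n.
Proof.
move=> /subnK <-; elim: (n - m)%N => // k IHk g mg; rewrite addSn; left.
exact: IHk.
Qed.

Lemma ball1 l n : ball l n 1.
Proof. exact: (@ball_le l 0). Qed.

Lemma ball_nontrivial l n g : ball l n g -> g <> 1 ->
  exists a : subgroup_type (H l), relator_symbols (factor a).
Proof.
elim: n g => [//|n IHn] g /= [/IHn//|[_ [a aR _] _]] _.
by exists a.
Qed.

(* The minimum of [B] and the word length of [g]. *)
Definition ball_dist (l : L) (B : nat) (g : G) : nat :=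
  \sum_(m < B) `[< ~ ball l m g >].

Lemma ball_dist_far l B g : ~ ball l B g -> ball_dist l B g = B.
Proof.
move=> Bg; rewrite /ball_dist -[RHS]muln1 -[in RHS](card_ord B) -sum_nat_const.
apply: eq_bigr => m _; rewrite asboolT // => /(ball_le (ltnW (ltn_ord m))).
exact: Bg.
Qed.

Lemma ball_dist1 l B : ball_dist l B 1 = 0%N.
Proof.
rewrite /ball_dist big1 // => m _; rewrite asboolF // => /(_ (ball1 _ _)).
by [].
Qed.

Lemma ball_dist_step l B g g' :
  (forall m, ball l m g -> ball l m.+1 g') ->
  (ball_dist l B g' <= (ball_dist l B g).+1)%N.
Proof.
move=> gg'; case: B => [|B]; first by rewrite /ball_dist big_ord0.
rewrite /ball_dist big_ord_recl big_ord_recr /= -add1n.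
apply: leq_add; first exact: leq_b1.
rewrite -[leqLHS]addn0; apply: leq_add => //; apply: leq_sum => m _ /=.
by case: asboolP => // ng'; case: asboolP => // /contrapT/gg'/ng'.
Qed.

Definition potential (l : L) (B : nat) (l' : L) (g : G) : int :=
  if `[< l' = l >] then Posz (ball_dist l B g) else 0%R.

(** Outside [H l] the truncated length is constantly [B], so only letters of [H l] read inside the
    coset [H l] itself can change it. *)
Lemma potential_avoid l B l' g h : ~ (l' = l /\ (H l : set G) g) ->
  (H l' : set G) h -> potential l B l' (g * h) = potential l B l' g.
Proof.
move=> lg Hh; rewrite /potential; case: asboolP => // l'l; subst l'.
have ng : ~ (H l : set G) g by move=> ?; apply: lg.
rewrite !ball_dist_far // => /ball_subgroup // Hg; apply: ng.
by rewrite -(mulgK h g); apply: subgroupM => //; apply: subgroupV.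
Qed.

Lemma potential_symbol l B g (a : symbol) : relator_symbols a ->
  (`|cocycle_symbol (potential l B) g a| <= 1 :> int)%R.
Proof.
case: a => [//|l' a aR] /=; rewrite /potential; case: asboolP => // l'l.
subst l'; have pa : relator_parts l (val a) by exists a.
have : (ball_dist l B (g * val a) <= (ball_dist l B g).+1)%N.
  apply: ball_dist_step => m mg; right; exists (val a) => //; right.
  by rewrite mulgK.
have : (ball_dist l B g <= (ball_dist l B (g * val a)).+1)%N.
  by apply: ball_dist_step => m mg; right; exists (val a) => //; left.
move: (ball_dist l B g) (ball_dist l B (g * val a)) => x y.
lia.
Qed.

(** Each symbol of a relator changes the length by at most one. The bound involves none of [l], [B],
    [g], so [B] may be chosen after it. *)
Lemma potential_relator l B g r : R r ->
  (`|cocycle (potential l B) g r| <= Posz (size (repr r : seq symbol)))%R.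
Proof.
move=> Rr; rewrite /cocycle.
have : forall a, List.In a (repr r : seq symbol) -> relator_symbols a.
  by move=> a ar; exists r.
elim: (repr r : seq symbol) g => [//|a u IHu] g au /=.
rewrite -add1n PoszD.
apply: Order.POrderTheory.le_trans (Num.Theory.ler_normD _ _) _.
apply: Num.Theory.lerD; first by apply: potential_symbol; apply: au; left.
by apply: IHu => b bu; apply: au; right.
Qed.

(* The path from [g] labelled [w] uses no edge of the coset [H l].  For [g] in
   [H l] this says that the first letter of the word [g w] is isolated. *)
Fixpoint avoids (l : L) (g : G) (w : seq (letter H X)) : Prop :=
  if w is a :: w' then
    (if a is inr (existT l' _) then ~ (l' = l /\ (H l : set G) g) else True)
    /\ avoids l (g * epsilon (letter_relF a)) w'
  else True.

Lemma word_relF_cons (a : letter H X) w :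
  word_relF (a :: w) = letter_relF a * word_relF w.
Proof. exact: big_cons. Qed.

Lemma cocycle_avoids l B g w :
  avoids l g w -> cocycle (potential l B) g (word_relF w) = 0%R.
Proof.
elim: w g => [|a w IHw] g /=; first by rewrite /word_relF big_nil cocycle1.
case=> ag aw; rewrite word_relF_cons cocycleM IHw // GRing.addr0.
rewrite cocycle_letter; case: a ag {aw} => [//|[l' h] lg].
by rewrite potential_avoid ?GRing.subrr //; apply: set_mem (valP (val h)).
Qed.

Hypothesis finR : finite_set R.
Hypothesis R1 : forall r, R r -> epsilon r = 1.
Hypothesis dehn : relative_Dehn_well_defined R.

Lemma finite_relator_symbols : finite_set relator_symbols.
Proof.
apply: (@sub_finite_set _ _
  (\bigcup_(r in R) [set a | List.In a (repr r : seq symbol)])).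
  by move=> a [r Rr ar]; exists r.
by apply: bigcup_finite => // r _; apply: finite_List_In.
Qed.

Lemma finite_ball l n : finite_set (ball l n).
Proof.
elim: n => [|n IHn]; first exact: finite_set1.
have finP : finite_set (relator_parts l).
  apply: (@sub_finite_set _ _ [set lift_word (fun x : X => val x)
    (fun (l : L) (h : subgroup_type (H l)) => val h) [:: a] |
    a in relator_symbols]); last exact/finite_image/finite_relator_symbols.
  by move=> _ [a aR <-]; exists (factor a) => //; rewrite /lift_word big_seq1.
apply: (@sub_finite_set _ _ (ball l n `|` \bigcup_(w in relator_parts l)
  ([set g * w^-1 | g in ball l n] `|` [set g * w | g in ball l n]))).
  move=> g [ng|[w pw [ng|ng]]]; first by left.
    by right; exists w => //; left; exists (g * w) => //; rewrite mulgK.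
  by right; exists w => //; right; exists (g * w^-1) => //; rewrite mulgVK.
rewrite finite_setU; split=> //; apply: bigcup_finite => // w _.
by rewrite finite_setU; split; apply: finite_image.
Qed.

Lemma relator_size : exists M,
  forall r, R r -> (size (repr r : seq symbol) <= M)%N.
Proof.
have [s sR] := (finite_seqP R).1 finR.
exists (\max_(r <- s) size (repr r : seq symbol)) => r.
by rewrite sR => rs; apply: leq_bigmax_seq.
Qed.

Lemma dehn_bound n : exists N, forall w : seq (letter H X), (size w <= n)%N ->
  epsilon (word_relF w) = 1 ->
  exists2 k, conjugates_product R k (word_relF w) & (k <= N)%N.
Proof.
have := @dehn n; case E: (relative_Dehn R n) => [N|//] _; exists N => w wn w1.
apply/enat_inf_le; have /enat_sup_le : enat_le (relative_Dehn R n) N.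
  by rewrite E /=.
by apply; exists w.
Qed.

Lemma isolated_component n : exists B, forall l h (w : seq (letter H X)),
  (H l : set G) h -> (size w <= n)%N -> h * epsilon (word_relF w) = 1 ->
  avoids l h w -> ball l B h.
Proof.
have [M RM] := relator_size; have [N wN] := dehn_bound n.+1.
exists (N * M).+1 => l h w Hh wn hw1 avw; set B := (N * M).+1.
have [->|h1] := eqVneq h 1; first exact: ball1.
have [a aE] : exists a : subgroup_type (H l), val a = h.
  exact: subgroup_elt.
have a1 : a != 1 by apply: contra_neq h1 => a1; rewrite -aE a1.
pose a' : letter H X := inr (existT _ l (exist _ a a1)).
have ea' : epsilon (letter_relF a') = h by rewrite epsilon_letter /= aE.
have [k wk kN] : exists2 k,
    conjugates_product R k (word_relF (a' :: w)) & (k <= N)%N.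
  by apply: wN => //=; rewrite word_relF_cons epsilonM ea'.
have := @cocycle_conjugates_product _ _ _ _ (potential l B) M R k 1 _ R1 _ wk.
rewrite word_relF_cons cocycleM ea' mul1g cocycle_avoids // GRing.addr0.
rewrite cocycle_letter /= mul1g aE /potential asboolT // ball_dist1.
have [//|nB] := pselect (ball l B h); rewrite (ball_dist_far nB) => hM.
have kM : (k * M <= N * M)%N by rewrite leq_mul2r kN orbT.
have : (`|Posz B - Posz 0| <= Posz (k * M))%R.
  apply: hM => r g Rr; apply: Order.POrderTheory.le_trans.
    exact: potential_relator.
  exact: RM.
by rewrite /B; lia.
Qed.

End Isolated.

(** * Fineness of the coned-off Cayley graph *)

Section ConedOff.
Variables (G : groupType) (L : Type) (H : L -> subgroup G) (X : set G).

(* [Coset l C] is an isolated vertex when [C] is not a left coset of [H l]. *)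
Inductive vertex :=
  | Elt (g : G)
  | Coset (l : L) (C : set G).

Definition coset (l : L) (g : G) : set G := [set k | (H l : set G) (g^-1 * k)].

Definition coned_adj (u v : vertex) : Prop :=
  match u, v with
  | Elt g, Elt h => exists2 x, X x & h = g * x
  | Elt g, Coset l C | Coset l C, Elt g => C = coset l g
  | Coset _ _, Coset _ _ => False
  end.

Definition coned_act (g : G) (u : vertex) : vertex :=
  match u with
  | Elt h => Elt (g * h)
  | Coset l C => Coset l [set k | C (g^-1 * k)]
  end.

Lemma coset_refl l g : coset l g g.
Proof. by rewrite /coset /= mulVg; apply: subgroup1. Qed.

Lemma coset_eq l g h : coset l g h -> coset l g = coset l h.
Proof.
rewrite /coset => /= gh; apply/seteqP; split=> k /= Hk.
  have -> : h^-1 * k = (g^-1 * h)^-1 * (g^-1 * k).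
    by rewrite invgM invgK -mulgA mulVKg.
  by apply: subgroupM => //; apply: subgroupV.
have -> : g^-1 * k = (g^-1 * h) * (h^-1 * k) by rewrite -mulgA mulVKg.
exact: subgroupM.
Qed.

Lemma act_coset g l h :
  coned_act g (Coset l (coset l h)) = Coset l (coset l (g * h)).
Proof.
by congr Coset; apply/seteqP; split=> k; rewrite /coset /= invgM mulgA.
Qed.

Lemma coned_act1 u : coned_act 1 u = u.
Proof.
case: u => [g|l C] /=; first by rewrite mul1g.
by congr Coset; apply/seteqP; split=> k /=; rewrite invg1 mul1g.
Qed.

Lemma coned_actM g h u : coned_act (g * h) u = coned_act g (coned_act h u).
Proof.
case: u => [k|l C] /=; first by rewrite mulgA.
by congr Coset; apply/seteqP; split=> k /=; rewrite invgM mulgA.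
Qed.

Lemma coned_act_adj g u v :
  coned_adj u v -> coned_adj (coned_act g u) (coned_act g v).
Proof.
case: u v => [h|l C] [h'|l' C'] //=.
- by case=> x Xx ->; exists x; rewrite ?mulgA.
- by move=> ->; case: (act_coset g l' h).
- by move=> ->; case: (act_coset g l h').
Qed.

Hypothesis XV : forall x, X x -> X x^-1.

Lemma coned_adjC u v : coned_adj u v -> coned_adj v u.
Proof.
case: u v => [h|l C] [h'|l' C'] //=.
by case=> x Xx ->; exists x^-1; [exact: XV|rewrite mulgK].
Qed.

Lemma word_of_reach l n u g :
  reach coned_adj [set~ Coset l (coset l 1)] n u (Elt 1) ->
  (u = Elt g \/ exists l', u = Coset l' (coset l' g)) ->
  exists w : seq (letter H X),
    [/\ (size w <= n)%N, g * epsilon (word_relF w) = 1 & avoids l g w].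
Proof.
move Ev : (Elt 1) => v r.
elim: r g Ev => {n u v} [n _ _ g <-|n u u' v Pu uu' _ IH g Ev].
  case=> [[<-]|[l' //]]; exists [::]; split=> //.
  by rewrite /word_relF big_nil epsilon1 mulg1.
case=> [uE|[l' uE]]; subst u.
  case: u' uu' IH => [h [x Xx hE]|l' C CE] IH.
    have [w [wn hw lw]] := IH h Ev (or_introl erefl).
    exists (inl (exist _ x (mem_set Xx)) :: w); rewrite /= word_relF_cons.
    by rewrite epsilonM epsilon_letter /= mulgA -hE; split.
  have [|w [wn gw lw]] := IH g Ev _; first by right; exists l'; rewrite CE.
  by exists w; split=> //; apply: leqW.
case: u' uu' IH => [h /= gh|//] IH.
have [w [wn hw lw]] := IH h Ev (or_introl erefl).
have : coset l' g h by rewrite gh; apply: coset_refl.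
case/subgroup_elt => a aE; have [a1|a1] := eqVneq a 1.
  have <- : h = g by rewrite -[LHS](mulVKg g) -aE a1 mulg1.
  by exists w; split=> //; apply: leqW.
exists (inr (existT _ l' (exist _ a a1)) :: w).
rewrite /= word_relF_cons epsilonM epsilon_letter /= aE mulVKg.
split=> //; first by rewrite -mulgA mulVKg.
split=> //.
case=> l'l gl; apply: Pu; subst l'; congr Coset; apply/esym/coset_eq.
by rewrite /coset /= invg1 mul1g.
Qed.

Variable R : set (relF H X).
Hypotheses (finX : finite_set X) (finR : finite_set R).
Hypothesis R1 : forall r, R r -> epsilon r = 1.
Hypothesis dehn : relative_Dehn_well_defined R.

Lemma isolated_reach n : exists B, forall l g h,
  reach coned_adj [set~ Coset l (coset l g)] n (Elt h) (Elt g) ->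
  coset l g h -> ball R l B (g^-1 * h).
Proof.
have [B wB] := isolated_component finR R1 dehn n.
exists B => l g h r gh.
have := reach_act_avoid coned_act1 coned_actM coned_act_adj g^-1 r.
rewrite act_coset /= mulVg => {}r.
have [w [wn hw lw]] := word_of_reach r (or_introl erefl).
exact: wB lw.
Qed.

(** Two paths to [u] from neighbours of [v] close up to a circuit at [v]. At a coset vertex the
    difference of the two neighbours then lies in a finite ball; at an element, a coset neighbour
    other than a fixed [e0] must have an index [l] that occurs in a relator. *)
Lemma coned_fine n u v : u <> v ->
  finite_set [set e | coned_adj v e /\ reach coned_adj [set~ v] n e u].
Proof.
move=> uv; have [B nB] := isolated_reach (n + n).+1.
case: v => [g|l C] in uv *.
  pose E0 := [set e | (exists l, e = Coset l (coset l g)) /\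
                      reach coned_adj [set~ Elt g] n e u].
  suff finE0 : finite_set E0.
    apply: (@sub_finite_set _ _ ([set Elt (g * x) | x in X] `|` E0)).
      move=> [h|l C] [/= ge eu].
        by case: ge => x Xx ->; left; exists x.
      by right; split=> //; exists l; rewrite ge.
    by rewrite finite_setU; split=> //; apply: finite_image.
  have [[e0 [[l0 e0E] e0u]]|nE0] := pselect (exists e, E0 e); last first.
    by apply: (@sub_finite_set _ _ set0) => // e E0e; apply: nE0; exists e.
  (* Free letters get the harmless default [e0]. *)
  pose f (a : fsymbol X (fun l : L => subgroup_type (H l))) :=
    if a is @Ffactor _ _ _ l _ then Coset l (coset l g) else e0.
  apply: (@sub_finite_set _ _
    ([set e0] `|` [set f a | a in relator_symbols R])).
    move=> e [[l eE] eu]; have [->|ee0] := pselect (e = e0); [by left|right].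
    (* Cutting the path from [e] to [e0] at its last visit to [e] makes the component at [e]
       isolated. *)
    have := reach_trans eu (reach_sym coned_adjC e0u).
    case/(reach_last e) => [r|/ee0//|[[h|l' C] ge he0]]; last 1 first.
    - by rewrite eE in ge.
    - by case: (reach_start r) => _ [].
    have gh : coset l g h.
      by move: ge; rewrite eE /= => ->; apply: coset_refl.
    have hg : h <> g.
      by move=> E; case: (reach_start he0) => + _; rewrite E; apply.
    have r : reach coned_adj [set~ e] (n + n).+1 (Elt h) (Elt g).
      apply: reach_le (_ : ((n + n).-1 + 1 <= _)%N) _; first by lia.
      apply: (@reach_trans _ _ _ _ _ _ e0).
        by apply: reach_sub he0 => x [].
      apply: (@reach_cons _ _ _ _ _ (Elt g)); last first.
      - by apply: reach_nil; rewrite eE.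
      - by rewrite e0E.
      - by move=> /esym.
    rewrite eE in r; have hB := nB _ _ _ r gh.
    have [|a aR] := ball_nontrivial hB.
      by move=> E; apply: hg; rewrite -[h](mulVKg g) E mulg1.
    by exists (@Ffactor X L (fun l : L => subgroup_type (H l)) _ a).
  rewrite finite_setU; split; first exact: finite_set1.
  exact/finite_image/finite_relator_symbols.
have [[e [ve eu]]|nE] := pselect (exists e, coned_adj (Coset l C) e /\
    reach coned_adj [set~ Coset l C] n e u); last first.
  by apply: (@sub_finite_set _ _ set0) => // e Ee; apply: nE; exists e.
case: e => [g|//] /= in ve eu; subst C.
apply: (@sub_finite_set _ _ [set Elt (g * k) | k in ball R l B]).
  move=> [h|l' C'] [//= gh hu]; exists (g^-1 * h); last by rewrite mulVKg.
  apply: nB; last by rewrite gh; apply: coset_refl.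
  apply: reach_le (leqnSn _) _.
  exact: reach_trans hu (reach_sym coned_adjC eu).
exact/finite_image/finite_ball.
Qed.

End ConedOff.

(** * Bounded sets in the relative Cayley graph *)

Section Cayley.
Variables (G : groupType) (L : Type) (H : L -> subgroup G) (X : set G).

Local Notation cayley_reach := (reach (cayley_adj H X) setT).

Lemma cayley_dist_le g h n :
  enat_le (cayley_dist H X g h) n <-> cayley_reach n g h.
Proof.
rewrite enat_inf_le; split.
  case=> _ [p [gp gh <-]] pn; apply: reach_le pn _.
  elim: p g gp gh => [|k p IHp] g /=; first by move=> _ <-; apply: reach_nil.
  by case/andP=> gk kp ph; apply: reach_cons gk _ => //; apply: IHp.
elim=> {n g h} [n g _|n g k h _ gk _ [_ [p [kp ph <-]] pn]].
  by exists 0%N => //; exists [::].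
by exists (size p).+1 => //; exists (k :: p); rewrite /= gk.
Qed.

Lemma cayley_boundedP (K : set G) : ~ unbounded_in_cayley H X K <->
  exists N, forall g h, K g -> K h -> cayley_reach N g h.
Proof.
rewrite /unbounded_in_cayley; split.
  case E: (cayley_diam H X K) => [N|//] _; exists N => g h Kg Kh.
  apply/cayley_dist_le; have /enat_sup_le : enat_le (cayley_diam H X K) N.
    by rewrite E /=.
  by apply; exists g, h.
case=> N KN E.
have : enat_le (cayley_diam H X K) N; last by rewrite E.
by apply/enat_sup_le => _ [g [h [Kg Kh ->]]]; apply/cayley_dist_le/KN.
Qed.

Lemma cayley_adjC g h : cayley_adj H X g h -> cayley_adj H X h g.
Proof.
by move=> /asboolP[a ga]; apply/asboolP; exists a; case: ga; [right|left].
Qed.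

Lemma cayley_reach_mul k n g h :
  cayley_reach n g h -> cayley_reach n (k * g) (k * h).
Proof.
apply: reach_map => // x y /asboolP[a xy]; apply/asboolP; exists a.
by case: xy => ->; rewrite mulgA; [left|right].
Qed.

Lemma cayley_reach_letter g (a : letter H X) :
  cayley_reach 1 g (g * epsilon (letter_relF a)).
Proof.
apply: (@reach_cons _ _ _ _ _ (g * epsilon (letter_relF a))) => //.
  by apply/asboolP; exists a; left.
exact: reach_nil.
Qed.

Lemma cayley_reach_subgroup l g h : (H l : set G) h -> cayley_reach 1 g (g * h).
Proof.
case/subgroup_elt => a <-; have [->|a1] := eqVneq a 1.
  by rewrite mulg1; apply: reach_nil.
have := cayley_reach_letter g (inr (existT _ l (exist _ a a1))).
by rewrite epsilon_letter.
Qed.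

Lemma cayley_connected : relative_generating_set H X ->
  forall g, exists n, cayley_reach n 1 g.
Proof.
case=> _ gen g.
have : generated (X `|` \bigcup_l (H l : set G)) g by rewrite gen.
move=> /(_ [set h | exists n, cayley_reach n 1 h]); apply; split.
  split=> [|x y /set_mem[m m1x] /set_mem[n n1y]]; apply: mem_set.
    by exists 0%N; apply: reach_nil.
  exists (m + n)%N; apply: reach_trans m1x _.
  have := cayley_reach_mul (x * y^-1) (reach_sym cayley_adjC n1y).
  by rewrite mulgVK mulg1.
move=> x [Xx|[l _ Hx]]; exists 1%N.
  have := cayley_reach_letter 1 (inl (exist _ x (mem_set Xx))).
  by rewrite epsilon_letter mul1g.
by have := cayley_reach_subgroup 1 Hx; rewrite mul1g.
Qed.

(** The factor two comes from peripheral letters, which become two edges through a coset vertex. *)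
Lemma cayley_reach_coned n g h :
  relative_generating_set H X -> cayley_reach n g h ->
  reach (coned_adj H X) setT n.*2 (Elt L g) (Elt L h).
Proof.
case=> XV _; elim=> {n g h} [n g _|n g k h _ gk _ IH]; first exact: reach_nil.
have step x (a : letter H X) : reach (coned_adj H X) setT 2
    (Elt L x) (Elt L (x * epsilon (letter_relF a))).
  rewrite epsilon_letter; case: a => [y|[l [a a1]]].
    apply: (@reach_cons _ _ _ _ _ (Elt L (x * val y))) => //.
      by exists (val y) => //; apply: set_mem (valP y).
    exact: reach_nil.
  apply: (@reach_cons _ _ _ _ _ (Coset l (coset H l x))) => //.
  apply: (@reach_cons _ _ _ _ _ (Elt L (x * val a))) => //=; last first.
    exact: reach_nil.
  apply: coset_eq; rewrite /coset /= mulKg; exact: set_mem (valP a).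
rewrite doubleS -add2n; apply: reach_trans IH.
have adjC := coned_adjC (L := L) (H := H)
  (fun x Xx => set_mem (XV x (mem_set Xx))).
by move: gk => /asboolP[a [->|->]]; last apply: reach_sym.
Qed.

Lemma finite_cayley_bounded (K : set G) : relative_generating_set H X ->
  finite_set K -> ~ unbounded_in_cayley H X K.
Proof.
move=> /cayley_connected conn /finite_seqP[s ->]; apply/cayley_boundedP.
have [N sN] : exists N, forall g, g \in s -> cayley_reach N 1 g.
  elim: s => [|x s [N sN]]; first by exists 0%N.
  have [n nx] := conn x; exists (n + N)%N => g; rewrite inE => /predU1P[->|/sN].
    by apply: reach_le nx; apply: leq_addr.
  by apply: reach_le; apply: leq_addl.
exists (N + N)%N => g h /= /sN gN /sN hN.
exact: reach_trans (reach_sym cayley_adjC gN) hN.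
Qed.

Lemma conjugate_cayley_bounded (K : subgroup G) l :
  relative_generating_set H X -> conjugate_into K (H l) ->
  ~ unbounded_in_cayley H X K.
Proof.
move=> /cayley_connected conn [c [M [MH KM]]]; apply/cayley_boundedP.
have [n nc] := conn c.
suff cK g : (K : set G) g -> cayley_reach (n + (1 + n)) 1 g.
  exists ((n + (1 + n)) + (n + (1 + n)))%N => g h Kg Kh.
  exact: reach_trans (reach_sym cayley_adjC (cK g Kg)) (cK h Kh).
rewrite KM => -[m /MH Hm <-]; rewrite conjgE.
apply: (@reach_trans _ _ _ _ _ _ c^-1).
  have := cayley_reach_mul c^-1 nc; rewrite mulVg mulg1.
  exact: reach_sym cayley_adjC.
apply: (@reach_trans _ _ _ _ _ _ (c^-1 * m)).
  exact: cayley_reach_subgroup Hm.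
by have := cayley_reach_mul (c^-1 * m) nc; rewrite mulg1 mulgA.
Qed.

End Cayley.

Theorem theorem1p2 (G : groupType) (L : Type) (H : L -> subgroup G)
    (X : set G) (R : set (relF H X)) :
  finitely_generated G ->
  finite_relative_presentation R ->
  relative_Dehn_well_defined R ->
  forall K : subgroup G,
    exactly_one
      (finite_set K)
      (infinite_set K /\ exists l : L, conjugate_into K (H l))
      (unbounded_in_cayley H X K).
Proof.
move=> _ [[genX clR] finX finR] dehn K.
have [finK|infK] := pselect (finite_set K).
  constructor 1; split=> //; first by case.
  exact: finite_cayley_bounded.
suff : unbounded_in_cayley H X K \/ exists l, conjugate_into K (H l).
  have [unb _|bnd [//|[l Kl]]] := pselect (unbounded_in_cayley H X K).
    constructor 3; split=> // -[_ [l Kl]].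
    exact: conjugate_cayley_bounded genX Kl unb.
  by constructor 2; split=> //; split=> //; exists l.
have [|/cayley_boundedP[N KN]] := pselect (unbounded_in_cayley H X K).
  by left.
right; have R1 r : R r -> epsilon r = 1.
  move=> Rr; have : normal_closure R r by move=> A [_]; apply.
  by rewrite clR.
have XV x : X x -> X x^-1 by move=> /mem_set Xx; apply: set_mem (genX.1 x Xx).
have K1 := subgroup1 K.
have adjC := coned_adjC (H := H) XV.
have actadj := @coned_act_adj _ _ H X.
have fine := coned_fine XV finX finR R1 dehn.
have orbD k : (K : set G) k ->
    reach (coned_adj H X) setT N.*2 (Elt L 1) (coned_act k (Elt L 1)).
  by move=> Kk; rewrite /= mulg1; apply: cayley_reach_coned (KN _ _ K1 Kk).
have [D [y [fy [m xy] yD]]] :=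
  finite_orbit adjC (@coned_act1 _ _) (@coned_actM _ _) actadj fine
  (@subgroupM _ K) (@subgroupV _ K) orbD.
(* The action on elements is free: [k] is recovered from [k * g]. *)
have infelt g : ~ finite_set [set coned_act k (Elt L g) | k in (K : set G)].
  move=> fg; apply: infK.
  pose f (u : vertex G L) := if u is Elt h then h * g^-1 else 1.
  apply: sub_finite_set (finite_image f fg) => k Kk /=.
  by exists (Elt L (k * g)); [exists k|rewrite /= mulgK].
(* If [y] moved, [y] and some neighbour [e] would both have finite orbits, but one of two adjacent
   vertices is always an element. *)
have fixy k : (K : set G) k -> coned_act k y = y.
  move=> Kk; apply: contrapT => ky.
  have [e ye fe] :=
    moved_neighbor_orbit (@coned_act1 _ _) (@coned_actM _ _) actadj fine
    (@subgroupM _ K) fy yD Kk ky.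
  case: y xy ye fy {yD ky} => [g _ _ /infelt//|l C _].
  by case: e fe => [g /infelt|].
case: y xy fy fixy {yD} => [g _ /infelt//|l C xy _ fixy].
(* Being connected to [Elt L 1], the vertex has a neighbour, so [C] is a genuine coset. *)
have [g CE] : exists g, C = coset H l g.
  move/(reach_sym adjC) : xy => xy; inversion xy; subst.
  by case: w H1 => [g gS|//] in H2 *; exists g.
exists l; apply: (conjugate_intoP (g := g)) => k /fixy.
rewrite CE act_coset => -[kg]; rewrite -mulgA.
by have : coset H l g (k * g) by rewrite -kg; apply: coset_refl.
Qed.
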